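(* Let $k$ and $n$ be non-negative integers. Let $p_1,p_2,\ldots,p_{k+1}$ be primes such that $p_i\geq 5$ and $p_i\not\equiv 1 \pmod 6$ for each $1\leq i\leq k+1$. Then for any integer $j\not\equiv 0 \pmod{p_{k+1}}$, $$\bar{B}_{2,9}\left(18p_1^2p_2^2\cdots p_{k+1}^2 n + 3(6j+p_{k+1})p_1^2p_2^2\cdots p_k^2 p_{k+1}\right)\equiv 0 \pmod 3.$$
   Context: An overpartition of a positive integer $n$ is a partition of $n$ in which the first occurrence of each distinct part may be overlined. For coprime integers $\ell_1,\ell_2>1$, $\bar{B}_{\ell_1,\ell_2}(n)$ denotes the number of overpartitions of $n$ in which no part is divisible by $\ell_1$ or by $\ell_2$, with $\bar{B}_{\ell_1,\ell_2}(0)=1$. *)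

(* Defs.v *)
From mathcomp Require Import all_boot all_order all_algebra.
Set Implicit Arguments.
Unset Strict Implicit.
Unset Printing Implicit Defensive.

(* An overpartition is a weakly decreasing sequence of positive parts, each    *)
(* carrying a flag saying whether it is overlined; [index] returns the first   *)
(* position of a value, so only first occurrences may carry the flag.          *)
Definition overpartition (n : nat) (s : seq (nat * bool)) : bool :=
  let parts := unzip1 s in
  [&& sorted geq parts, all (leq 1) parts, sumn parts == n
    & [forall i : 'I_(size s),
        (nth (0, false) s i).2 ==> (index (nth (0, false) s i).1 parts == i)]].

Definition no_part_divisible (l1 l2 : nat) (s : seq (nat * bool)) : bool :=
  all (fun d => ~~ (l1 %| d) && ~~ (l2 %| d)) (unzip1 s).

Definition part_of_ord (n : nat) (x : 'I_n.+1 * bool) : nat * bool :=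
  (val x.1, x.2).

(* An overpartition of n has at most n parts, all at most n, so counting in    *)
(* this finite type misses none (see [overpartition_bseq]).                    *)
Definition num_overpart (l1 l2 n : nat) : nat :=
  #|[set s : {bseq n of 'I_n.+1 * bool} |
       overpartition n (map (@part_of_ord n) s)
       && no_part_divisible l1 l2 (map (@part_of_ord n) s)]|.

(* Extended by 0 to negative arguments. *)
Definition Bbar (l1 l2 : nat) (m : int) : nat :=
  match m with Posz n => num_overpart l1 l2 n | Negz _ => 0 end.

Lemma overpartition_bseq (n : nat) (s : seq (nat * bool)) :
  overpartition n s ->
  exists t : {bseq n of 'I_n.+1 * bool}, map (@part_of_ord n) t = s.
Proof.
case/and4P=> _ pos /eqP sum_s _.
have size_le : size s <= n.
  rewrite -sum_s; elim: s pos {sum_s} => //= x s IHs /andP[x_gt0 /IHs].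
  by rewrite -add1n; apply: leq_add.
have part_le x : x \in s -> x.1 <= n.
  rewrite -sum_s => xs; have {xs} : x.1 \in unzip1 s by apply: map_f.
  elim: (unzip1 s) => //= d r IHr; rewrite inE => /predU1P[-> | /IHr le_r].
    exact: leq_addr.
  exact: leq_trans le_r (leq_addl _ _).
pose f (x : nat * bool) : 'I_n.+1 * bool := (inord x.1, x.2).
have size_f : size (map f s) <= n by rewrite size_map.
exists (Bseq size_f) => /=; rewrite -map_comp map_id_in // => -[d b] /part_le /= d_le.
by rewrite /part_of_ord /f /= inordK.
Qed.

Lemma part_of_ord_inj (n : nat) : injective (@part_of_ord n).
Proof. by move=> [i b] [j c] [/val_inj -> ->]. Qed.

(* Main.v *)
(** Write [phi(q)] for the sum of [q ^ (x^2)] over all integers [x].  By the Jacobi triple product,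
    [phi(q) / phi(-q)] is the square of the product of [(1 + q^d) / (1 - q^d)] over odd [d], so
    modulo 3, where [f(q)^3 = f(q^3)], the generating function of the overpartitions counted here
    is [G = phi(-q)^4 / phi(q)^4].  Hence [G(q) phi(q^3)^2 = phi(-q^3) (phi(-q) phi(q)^2)], and
    extracting the exponents divisible by 3 only requires the extraction for
    [phi(-q) phi(q)^2]: counting the points of [x^2 + y^2 + z^2 = 3 n] modulo 3 on the four
    lattices [x = +-y = +-z mod 3] gives [phi(-q) phi(-q^2) phi(-q^6)].  With
    [phi(q) phi(-q) = phi(-q^2)^2] this yields
      [Bbar(3 m) = sum over x^2 + 3 y^2 = m of (-1)^(x + y)   (mod 3)].
    Primes congruent to 2 modulo 3 are inert in [Z[sqrt(-3)]], so the argument in the theorem,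
    which contains [p_(k+1)] to an odd power, is three times an integer not of the form
    [x^2 + 3 y^2].

    Power series are replaced by polynomials modulo ['X^N], and sums over integers by sums over
    large boxes. *)

Require Import Defs.
From mathcomp Require Import all_boot all_order all_algebra all_field.
From mathcomp Require Import zify ring.
Set Implicit Arguments.
Unset Strict Implicit.
Unset Printing Implicit Defensive.
Import Order.TTheory GRing.Theory Num.Theory.

(** * Overpartitions as paths *)

(* On weakly decreasing parts, overlining only first occurrences is a condition on
   adjacent entries. *)
Definition overR (x y : nat * bool) : bool := (y.1 < x.1) || ((y.1 == x.1) && ~~ y.2).

Definition flags_first (s : seq (nat * bool)) : bool :=
  [forall i : 'I_(size s),
    (nth (0, false) s i).2 ==> (index (nth (0, false) s i).1 (unzip1 s) == i)].

Lemma flags_first_cons x s :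
  flags_first (x :: s) = flags_first s && all (fun y => y.2 ==> (y.1 != x.1)) s.
Proof.
apply/forallP/andP => [h | [/forallP h /all_nthP a] i].
  split.
    apply/forallP => i; apply/implyP => fi.
    have := h (lift ord0 i); rewrite /= fi /= => /eqP.
    by case: eqP => // _ [->].
  apply/(all_nthP (0, false)) => i lt_i; apply/implyP => fi.
  have := h (lift ord0 (Ordinal lt_i)); rewrite /= fi /=.
  by rewrite (eq_sym _ x.1); case: (x.1 == _).
case: i => -[|i] lt_i /=; first by rewrite eqxx implybT.
apply/implyP => fi; have := h (Ordinal (lt_i : i < size s)); rewrite /= fi /= => /eqP ->.
by have := a (0, false) i lt_i; rewrite fi /= eq_sym => /negPf ->.
Qed.

(** If the next part is smaller than [x.1], so are all later ones, and no flag can clash with [x].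
    If it equals [x.1], its flag must be off, and later copies of it are already unflagged because
    [y] precedes them. *)
Lemma path_geq_overR x s :
  path overR x s = path geq x.1 (unzip1 s) && flags_first (x :: s).
Proof.
elim: s x => [|y s IHs] x /=.
  by symmetry; apply/forallP => -[[|i] lt_i] //=; rewrite eqxx implybT.
rewrite IHs (flags_first_cons x) /=.
case pg: (path geq y.1 (unzip1 s)); rewrite /= ?andbF ?andbT //.
case f: (flags_first (y :: s)); rewrite /= ?andbF ?andbT //.
have le_y : all (fun z => z.1 <= y.1) s.
  have geq_tr : transitive geq by move=> a b c h h'; exact: leq_trans h' h.
  by have := order_path_min geq_tr pg; rewrite all_map.
rewrite /overR; case: (ltngtP y.1 x.1) => //= [lt_yx|e].
  rewrite implybT; symmetry; apply: sub_all le_y => z le_z.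
  by apply/implyP => _; rewrite neq_ltn (leq_ltn_trans le_z lt_yx).
rewrite implybF -e; case: (~~ _) => //=.
by move: f; rewrite flags_first_cons => /andP[_ ->].
Qed.

Lemma overpartitionE n s : overpartition n s =
  [&& sorted overR s, all (fun x => 0 < x.1) s & sumn (unzip1 s) == n].
Proof.
rewrite /overpartition -/(flags_first s) all_map /=.
have -> : sorted overR s = sorted geq (unzip1 s) && flags_first s.
  case: s => [|x s] /=; last exact: path_geq_overR.
  by symmetry; apply/forallP => -[].
by rewrite -!andbA; do !bool_congr; rewrite andbC -andbA.
Qed.

Definition flagged_parts (n : nat) : seq (nat * bool) :=
  [seq (d, b) | d <- iota 1 n, b <- [:: true; false]].

Lemma flagged_parts_uniq n : uniq (flagged_parts n).
Proof. by rewrite allpairs_uniq ?iota_uniq // => -[a b] [a' b'] _ _ [-> ->]. Qed.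

Lemma mem_flagged_parts n y : (y \in flagged_parts n) = (0 < y.1 <= n).
Proof.
apply/allpairsPdep/idP => [[d [b [+ _ ->]]]|h]; first by rewrite mem_iota add1n ltnS.
exists y.1, y.2; rewrite mem_iota add1n ltnS -surjective_pairing; split=> //.
by case: y.2.
Qed.

Section Enumeration.
Variable ok : pred nat.

(* Paths for [overR] after the entry [x], with admissible positive parts of sum [n];
   [f] is fuel, enough as soon as [n <= f]. *)
Fixpoint over_after (f : nat) (x : nat * bool) (n : nat) : seq (seq (nat * bool)) :=
  if n == 0 then [:: [::]] else
  if f is f'.+1 then
    [seq y :: s | y <- [seq y <- flagged_parts n | overR x y && ok y.1],
                  s <- over_after f' y (n - y.1)]
  else [::].

Lemma over_afterS f x n : over_after f.+1 x n.+1 =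
  [seq y :: s | y <- [seq y <- flagged_parts n.+1 | overR x y && ok y.1],
                s <- over_after f y (n.+1 - y.1)].
Proof. by []. Qed.

Lemma over_after_uniq f x n : uniq (over_after f x n).
Proof.
elim: f x n => [|f IHf] x n /=; case: eqP => // _.
apply: allpairs_uniq_dep => [|y _|[a s] [b t] _ _ /= [-> ->]] //.
by rewrite filter_uniq // flagged_parts_uniq.
Qed.

Lemma mem_over_after f x n s : n <= f ->
  (s \in over_after f x n) =
  [&& path overR x s, all (fun y => (0 < y.1) && ok y.1) s & sumn (unzip1 s) == n].
Proof.
elim: f x n s => [|f IHf] x n s /=.
  rewrite leqn0 => /eqP->; rewrite eqxx inE; case: s => //= y s.
  apply/esym/negP => /and3P[_ /andP[/andP[y0 _] _]].
  by rewrite addn_eq0 => /andP[/eqP y0']; rewrite y0' in y0.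
case: (posnP n) => [-> _ | n0 nf].
  rewrite inE; case: s => //= y s.
  apply/esym/negP => /and3P[_ /andP[/andP[y0 _] _]].
  by rewrite addn_eq0 => /andP[/eqP y0']; rewrite y0' in y0.
have le_sub d : 0 < d -> n - d <= f.
  by move=> d0; rewrite leq_subLR (leq_trans nf) // -add1n leq_add2r.
apply/allpairsPdep/and3P => [[y [t [+ + ->]]] | ].
  rewrite mem_filter => /andP[/andP[xy oky]]; rewrite mem_flagged_parts => /andP[d1 d2].
  rewrite IHf ?le_sub // => /and3P[pt at_ /eqP st].
  by rewrite /= xy pt oky at_ d1 st subnKC.
case: s => [|y s] /=; first by case=> _ _ /eqP n00; rewrite -n00 in n0.
case=> /andP[xy ps] /andP[/andP[y0 oky] as_] /eqP e.
exists y, s; split=> //.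
  rewrite mem_filter xy oky mem_flagged_parts y0 -e; exact: leq_addr.
by rewrite IHf ?le_sub // ps as_ /= -e addKn.
Qed.

(** Continuations after an entry with part [d]: parts at most [d], with [d] itself not overlined.
    [overR] never reads the flag of its left argument, so the choice of [true] is immaterial. *)
Definition num_after (d n : nat) : nat := size (over_after n (d, true) n).

Lemma size_over_after f x n : n <= f -> size (over_after f x n) = num_after x.1 n.
Proof.
move=> nf; apply/perm_size/uniq_perm; rewrite ?over_after_uniq // => s.
by rewrite !mem_over_after //; case: s.
Qed.

(** The weight counts the flags allowed on the next part [e]: two if [e < d], one if [e = d], none
    otherwise. *)
Lemma num_afterS d n : num_after d n.+1 =
  \sum_(1 <= e < n.+2 | ok e) ((e < d) + (e <= d)) * num_after e (n.+1 - e).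
Proof.
rewrite {1}/num_after over_afterS size_allpairs_dep sumnE big_map big_filter.
rewrite big_seq_cond.
rewrite (eq_bigr (fun y => num_after y.1 (n.+1 - y.1))); last first.
  move=> y /andP[]; rewrite mem_flagged_parts => /andP[y0 _] _.
  by apply: size_over_after; rewrite leq_subLR -add1n leq_add2r.
rewrite -big_seq_cond big_mkcond /flagged_parts big_allpairs_dep /= /index_iota subSS subn0.
rewrite [RHS]big_mkcond /=; apply: eq_bigr => e _.
rewrite !big_cons big_nil /overR /= andbF orbF andbT.
case: (ok e); rewrite ?andbF // !andbT.
by case: (ltngtP e d) => //= _; rewrite ?mul1n ?mul0n ?add0n ?addn0 // mul2n addnn.
Qed.

Lemma num_after_0l n : num_after 0 n = (n == 0).
Proof.
case: n => // n; rewrite num_afterS big_nat_cond big1 // => e /andP[/andP[e0 _] _].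
by rewrite ltn0 leqNgt e0.
Qed.

(** From [d] to [d.+1] the weights in [num_afterS] grow by one at [e = d] and at [e = d.+1]. For
    generating functions this reads [G_(d+1) (1 - q^(d+1)) = G_d (1 + q^d)], for admissible
    parts. *)
Lemma num_after_rec d n : num_after d.+1 n = num_after d n
  + (if [&& 0 < d, d <= n & ok d] then num_after d (n - d) else 0)
  + (if (d.+1 <= n) && ok d.+1 then num_after d.+1 (n - d.+1) else 0).
Proof.
case: n => [|n]; first by rewrite leqn0 andbCA; case: d.
rewrite [LHS]num_afterS [num_after d n.+1]num_afterS.
have pick i : 0 < i -> (if (i <= n.+1) && ok i then num_after i (n.+1 - i) else 0)
    = \sum_(1 <= e < n.+2 | ok e) (e == i) * num_after e (n.+1 - e).
  move=> i0; have := @big_nat1_cond_eq nat 0 addn (fun e => num_after e (n.+1 - e)) ok i 1 n.+2.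
  rewrite i0 ltnS /= => <-; rewrite big_mkcondr /=; apply: eq_bigr => e _.
  by case: eqP => _; rewrite ?mul1n.
have -> : (if [&& 0 < d, d <= n.+1 & ok d] then num_after d (n.+1 - d) else 0)
    = \sum_(1 <= e < n.+2 | ok e) (e == d) * num_after e (n.+1 - e).
  case: (posnP d) => [-> | d0]; last by rewrite -pick.
  by rewrite big_nat_cond big1 // => -[].
rewrite pick // -!big_split /=; apply: eq_bigr => e _; rewrite -!mulnDl; congr (_ * _).
by clear; lia.
Qed.
End Enumeration.

(** A virtual first entry [D > n] exceeds every part, hence imposes no condition on the entries that
    follow. *)
Lemma num_overpartE (l1 l2 n D : nat) : n < D ->
  num_overpart l1 l2 n = num_after (fun d => ~~ (l1 %| d) && ~~ (l2 %| d)) D n.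
Proof.
move=> nD; rewrite /num_overpart cardE /num_after.
set A := [set _ | _]; set ok := fun d => _.
have inj : injective (fun s : {bseq n of 'I_n.+1 * bool} => map (@part_of_ord n) s).
  by move=> s t /(inj_map (@part_of_ord_inj n)) /val_inj.
rewrite -(size_map (fun s : {bseq n of 'I_n.+1 * bool} => map (@part_of_ord n) s)).
apply/perm_size/uniq_perm.
- by rewrite map_inj_uniq ?enum_uniq.
- exact: over_after_uniq.
move=> s; rewrite mem_over_after //.
have -> : [&& path overR (D, true) s, all (fun y => (0 < y.1) && ok y.1) s
    & sumn (unzip1 s) == n] = overpartition n s && no_part_divisible l1 l2 s.
  rewrite overpartitionE /no_part_divisible all_map.
  rewrite (all_predI (fun y => 0 < y.1) (fun y => ok y.1)).
  rewrite -!andbA [X in _ && (_ && X)]andbC; case: eqP => [e|]; rewrite ?andbF // !andTb.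
  congr (_ && _); case: s e => //= y s e.
  by rewrite /overR /= (leq_ltn_trans _ nD) // -e leq_addr.
apply/mapP/idP => [[t]|h].
  by rewrite mem_enum inE => h ->.
have [t et] : exists t : {bseq n of 'I_n.+1 * bool}, map (@part_of_ord n) t = s.
  by apply: overpartition_bseq; case/andP: h.
by exists t; rewrite // mem_enum inE et.
Qed.

Local Open Scope ring_scope.

(** * Lattice sums *)

Lemma eq_big_bij (R : nmodType) (S T : eqType) (s : seq S) (t : seq T)
    (P : pred S) (Q : pred T) (f : S -> R) (g : T -> R) (h : S -> T) (k : T -> S) :
    uniq s -> uniq t ->
    {in s, forall x, P x -> [/\ h x \in t, Q (h x), k (h x) = x & f x = g (h x)]} ->
    {in t, forall y, Q y -> [/\ k y \in s, P (k y) & h (k y) = y]} ->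
  (\sum_(x <- s | P x) f x = \sum_(y <- t | Q y) g y)%R.
Proof.
move=> us ut hP kQ; rewrite -big_filter -[RHS]big_filter.
have -> : (\sum_(x <- filter P s) f x = \sum_(x <- filter P s) g (h x))%R.
  rewrite big_seq [RHS]big_seq; apply: eq_bigr => x.
  by rewrite mem_filter => /andP[Px xs]; case: (hP x xs Px).
rewrite -(big_map h xpredT g); apply/perm_big/uniq_perm.
- rewrite map_inj_in_uniq ?filter_uniq // => x y; rewrite !mem_filter.
  move=> /andP[Px xs] /andP[Py ys] e.
  by have [_ _ <- _] := hP x xs Px; have [_ _ <- _] := hP y ys Py; rewrite e.
- exact: filter_uniq.
move=> y; rewrite mem_filter; apply/mapP/andP => [[x]|[Qy yt]].
  by rewrite mem_filter => /andP[Px xs] ->; have [] := hP x xs Px.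
by have [ks Pk <-] := kQ y yt Qy; exists (k y); rewrite // mem_filter Pk.
Qed.

Definition box (K : nat) : seq int := [seq (i%:Z - K%:Z)%R | i <- iota 0 K.*2.+1].

Lemma box_uniq K : uniq (box K).
Proof. by rewrite map_inj_uniq ?iota_uniq // => i j /addIr[]. Qed.

Lemma mem_box K (x : int) : (x \in box K) = (`|x|%N <= K)%N.
Proof.
apply/mapP/idP => [[i]|le]; first by rewrite mem_iota => h ->; lia.
by exists (absz (x + K%:Z)); rewrite ?mem_iota; lia.
Qed.

Definition box2 (K : nat) : seq (int * int) := [seq (x, y) | x <- box K, y <- box K].

Lemma box2_uniq K : uniq (box2 K).
Proof. by rewrite allpairs_uniq ?box_uniq // => -[x y] [x' y'] _ _ [-> ->]. Qed.

Lemma mem_box2 K (x y : int) : ((x, y) \in box2 K) = (`|x| <= K)%N && (`|y| <= K)%N.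
Proof.
rewrite -!mem_box; apply/idP/andP => [/allpairsPdep[x' [y' [? ? [-> ->]]]] //|[hx hy]].
by apply/allpairsPdep; exists x, y.
Qed.

Definition box3 (K : nat) : seq (int * int * int) := [seq (xy, z) | xy <- box2 K, z <- box K].

Lemma box3_uniq K : uniq (box3 K).
Proof. by rewrite allpairs_uniq ?box2_uniq ?box_uniq // => -[x y] [x' y'] _ _ [-> ->]. Qed.

Lemma mem_box3 K (x y z : int) :
  ((x, y, z) \in box3 K) = [&& `|x| <= K, `|y| <= K & `|z| <= K]%N.
Proof.
rewrite andbA -mem_box2 -mem_box; apply/idP/andP.
  by case/allpairsPdep=> xy [z' [? ? [-> ->]]].
by case=> hxy hz; apply/allpairsPdep; exists (x, y), z.
Qed.

Lemma absz_le_sqr (x : int) : (`|x|%N%:Z <= x ^+ 2)%R.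
Proof. nia. Qed.

Definition sgn (R : pzRingType) (x : int) : R := ((-1) ^+ `|x|%N)%R.
Arguments sgn {R} x.
Lemma sgnE (R : pzRingType) (x y : int) : ((x %% 2%:Z)%Z = (y %% 2%:Z)%Z) -> sgn x = sgn y :> R.
Proof. by move=> h; rewrite /sgn -signr_odd -[RHS]signr_odd; congr (_ ^+ _)%R; lia. Qed.

Lemma sgnS (R : pzRingType) (x y : int) :
  ((x %% 2%:Z)%Z = ((y + 1) %% 2%:Z)%Z) -> sgn x = - sgn y :> R.
Proof.
move=> h; rewrite /sgn -signr_odd -[in RHS]signr_odd.
have -> : odd `|x| = ~~ odd `|y| by lia.
by case: (odd _); rewrite ?opprK.
Qed.

Lemma sgnM (R : pzRingType) (x y : int) : sgn x * sgn y = sgn (x + y) :> R.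
Proof.
have e : odd `|x + y| = odd (`|x| + `|y|) by lia.
by rewrite /sgn -exprD -[RHS]signr_odd e signr_odd.
Qed.

(** Since 3 divides the sum of squares, it divides all of [x], [y], [z] or none. In the first case
    all four conditions hold, and 4 is 1 modulo 3; in the second exactly one choice of signs
    works. *)
Lemma three_squares_sign_classes (x y z : int) (n : nat) :
  x ^+ 2 + y ^+ 2 + z ^+ 2 = (3 * n)%:Z ->
  let d (u : int) := (3%:Z %| u)%Z in
  (d (x - y)%R && d (x - z)%R + d (x + y)%R && d (x - z)%R
   + d (x - y)%R && d (x + z)%R + d (x + y)%R && d (x + z)%R = 1 %[mod 3])%N.
Proof.
move=> + d; rewrite /d {d}.
have dec w : exists a (r : int), w = a * 3%:Z + r /\ (r = 0 \/ r = 1 \/ r = -1).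
  by exists ((w + 1) %/ 3%:Z)%Z, (w - ((w + 1) %/ 3%:Z)%Z * 3%:Z); lia.
have [a [r [-> hr]]] := dec x; have [b [s [-> hs]]] := dec y; have [c [t [-> ht]]] := dec z.
have sq q u : (q * 3%:Z + u) ^+ 2 = (3%:Z * q ^+ 2 + 2%:Z * q * u) * 3%:Z + u ^+ 2 by ring.
rewrite !sq.
set A := 3%:Z * a ^+ 2 + 2%:Z * a * r.
set B := 3%:Z * b ^+ 2 + 2%:Z * b * s.
set C := 3%:Z * c ^+ 2 + 2%:Z * c * t.
move: A B C => A B C.
case: hr => [->|[->|->]]; case: hs => [->|[->|->]]; case: ht => [->|[->|->]].
all: rewrite ?sqrrN ?expr1n ?expr0n /=; lia.
Qed.

(** Changing the signs of [y] and [z] exchanges the four lattices and fixes the summand, so the four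
    sums agree; by [three_squares_sign_classes] they add up to the full sum modulo 3. *)
Lemma sum_three_squares_split (R : comNzRingType) (K n : nat) : 3%:R = 0 :> R ->
  \sum_(t <- box3 K | t.1.1 ^+ 2 + t.1.2 ^+ 2 + t.2 ^+ 2 == (3 * n)%:Z) sgn t.1.1 =
  \sum_(t <- box3 K | [&& t.1.1 ^+ 2 + t.1.2 ^+ 2 + t.2 ^+ 2 == (3 * n)%:Z,
       (3%:Z %| t.1.1 - t.1.2)%Z & (3%:Z %| t.1.1 - t.2)%Z]) sgn t.1.1 :> R.
Proof.
move=> R3.
pose Q (t : int * int * int) := t.1.1 ^+ 2 + t.1.2 ^+ 2 + t.2 ^+ 2 == (3 * n)%:Z.
pose L e e' (t : int * int * int) :=
  [&& Q t, (3%:Z %| t.1.1 - e * t.1.2)%Z & (3%:Z %| t.1.1 - e' * t.2)%Z].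
rewrite -/Q (eq_bigl (L 1 1) _ (P1 := fun t => [&& _, _ & _])); last first.
  by move=> t; rewrite /L !mul1r.
have flip e e' : (e == 1) || (e == -1) -> (e' == 1) || (e' == -1) ->
    \sum_(t <- box3 K | L 1 1 t) sgn t.1.1 = \sum_(t <- box3 K | L e e' t) sgn t.1.1 :> R.
  move=> he he'.
  have [e2 e2'] : e * e = 1 /\ e' * e' = 1.
    by split; [case/orP: he => /eqP-> | case/orP: he' => /eqP->].
  have [ea ea'] : `|e|%N = 1%N /\ `|e'|%N = 1%N.
    by split; [case/orP: he => /eqP-> | case/orP: he' => /eqP->].
  pose h (t : int * int * int) : int * int * int := (t.1.1, e * t.1.2, e' * t.2).
  have hK t : h (h t) = t.
    by case: t => -[x y] z; rewrite /h /= !mulrA e2 e2' !mul1r.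
  have hb t : (h t \in box3 K) = (t \in box3 K).
    by case: t => -[x y] z; rewrite /h /= !mem_box3 !abszM ea ea' !mul1n.
  have hL t : L e e' (h t) = L 1 1 t.
    rewrite /L /Q /h /= !mulrA e2 e2' !mul1r; congr (_ && _).
    by rewrite !exprMn !expr2 e2 e2' !mul1r.
  apply: (eq_big_bij (h := h) (k := h)); rewrite ?box3_uniq // => t tK Lt.
    by rewrite hb hK hL.
  by rewrite hb hK -hL hK.
set S := RHS.
(* Here [S = 4 S] because 3 vanishes in [R], and each copy of [S] is moved to one of the four
   lattices. *)
have S4 : S = \sum_(t <- box3 K | L 1 1 t) sgn t.1.1 + \sum_(t <- box3 K | L (-1) 1 t) sgn t.1.1
   + \sum_(t <- box3 K | L 1 (-1) t) sgn t.1.1 + \sum_(t <- box3 K | L (-1) (-1) t) sgn t.1.1.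
  rewrite -!flip // -/S; transitivity (S + 3%:R * S); last by ring.
  by rewrite R3 mul0r addr0.
rewrite {}S4 !(big_mkcond (L _ _)) /= big_mkcond -!big_split /=.
apply: eq_bigr => -[[x y] z] _; rewrite /L /Q /=.
case: eqP => [/three_squares_sign_classes/=|_]; last by rewrite /= !addr0.
rewrite !mulN1r !mul1r !opprK.
do 4!case: (_ %| _)%Z; rewrite //= ?addr0 ?add0r // => _.
by transitivity ((1 + 3%:R) * sgn x : R); [rewrite R3 addr0 mul1r | ring].
Qed.

Lemma hexagonal_bound (b c : int) :
  (`|b|%N%:Z <= 2%:Z * (b ^+ 2 - b * c + c ^+ 2)) &&
  (`|c|%N%:Z <= 2%:Z * (b ^+ 2 - b * c + c ^+ 2)).
Proof.
have -> : 2%:Z * (b ^+ 2 - b * c + c ^+ 2) = (b - c) ^+ 2 + b ^+ 2 + c ^+ 2 by ring.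
have := sqr_ge0 (b - c); have := sqr_ge0 b; have := sqr_ge0 c.
have := absz_le_sqr b; have := absz_le_sqr c.
by move: ((b - c) ^+ 2) (b ^+ 2) (c ^+ 2) => u v w; lia.
Qed.

(** Solutions lie in the box automatically, so the changes of variables below never leave it. *)
Lemma hexagonal_box_bound (K n : nat) (s b c : int) : (3 * n <= K)%N ->
  s ^+ 2 + 2%:Z * (b ^+ 2 - b * c + c ^+ 2) = n%:Z ->
  [&& `|s| <= K, `|b| <= K & `|c| <= K]%N.
Proof.
move=> nK; have := hexagonal_bound b c; have := absz_le_sqr s; have := sqr_ge0 s.
by move: (s ^+ 2) (2%:Z * _) => u v; lia.
Qed.

Lemma sum3_box_bound (K n : nat) (u v w x y z : int) : (n <= K)%N ->
  `|x|%N%:Z <= u -> `|y|%N%:Z <= v -> `|z|%N%:Z <= w -> u + v + w = n%:Z ->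
  [&& `|x| <= K, `|y| <= K & `|z| <= K]%N.
Proof. by lia. Qed.

(* For [x = y = z] modulo 3 write [y = x + 3 b], [z = x + 3 c], [s = x + b + c]. *)
Lemma sum_three_squares_lattice (R : pzRingType) (K n : nat) : (3 * n <= K)%N ->
  \sum_(t <- box3 K | [&& t.1.1 ^+ 2 + t.1.2 ^+ 2 + t.2 ^+ 2 == (3 * n)%:Z,
       (3%:Z %| t.1.1 - t.1.2)%Z & (3%:Z %| t.1.1 - t.2)%Z]) sgn t.1.1 =
  \sum_(t <- box3 K | t.1.1 ^+ 2 + 2%:Z * (t.1.2 ^+ 2 - t.1.2 * t.2 + t.2 ^+ 2) == n%:Z)
     sgn (t.1.1 + t.1.2 + t.2) :> R.
Proof.
move=> nK; have bnd := hexagonal_box_bound nK.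
pose h (t : int * int * int) : int * int * int :=
  let b := ((t.1.2 - t.1.1) %/ 3%:Z)%Z in let c := ((t.2 - t.1.1) %/ 3%:Z)%Z in
  (t.1.1 + b + c, b, c).
pose k (t : int * int * int) : int * int * int :=
  let x := t.1.1 - t.1.2 - t.2 in (x, x + 3%:Z * t.1.2, x + 3%:Z * t.2).
have hk t : h (k t) = t.
  case: t => -[s b] c; rewrite /h /k /=.
  have d (u v : int) : ((u + 3%:Z * v - u) %/ 3%:Z)%Z = v by lia.
  by rewrite !d; congr (_, _, _); lia.
apply: (eq_big_bij (h := h) (k := k)); rewrite ?box3_uniq //.
- case=> -[x y] z _ /and3P[/=].
  set b := ((y - x) %/ 3%:Z)%Z; set c := ((z - x) %/ 3%:Z)%Z => /eqP e hy hz.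
  have [ye ze] : y = x + 3%:Z * b /\ z = x + 3%:Z * c by lia.
  (* The sum of the three squares is [3 x^2 + 6 x (b + c) + 9 (b^2 + c^2)], three times the
     left-hand side. *)
  have e' : (x + b + c) ^+ 2 + 2%:Z * (b ^+ 2 - b * c + c ^+ 2) = n%:Z.
    have n3 : (3 : int) != 0 by [].
    by apply: (mulfI n3); rewrite -PoszM -e ye ze; ring.
  rewrite /k /h /= -/b -/c mem_box3 e' eqxx; split=> //.
  + exact: bnd.
  + by rewrite ye ze; congr (_, _, _); lia.
  + by apply: sgnE; lia.
case=> -[s b] c _ /= /eqP e.
have e' : let x := s - b - c in x ^+ 2 + (x + 3%:Z * b) ^+ 2 + (x + 3%:Z * c) ^+ 2 = (3 * n)%:Z.
  by rewrite PoszM -e /=; ring.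
split=> //; last first.
  by rewrite /k /= e' eqxx /=; lia.
by rewrite /k mem_box3 /=; apply: sum3_box_bound nK _ _ _ e'; exact: absz_le_sqr.
Qed.

(* The part with [c] odd cancels: [(b, c) -> (-c, b - c)] preserves [b^2 - b c + c^2]
   and exchanges the two parities of [b]. *)
Lemma sum_hexagonal_lattice (R : pzRingType) (K n : nat) : (3 * n <= K)%N ->
  \sum_(t <- box3 K | t.1.1 ^+ 2 + 2%:Z * (t.1.2 ^+ 2 - t.1.2 * t.2 + t.2 ^+ 2) == n%:Z)
     sgn (t.1.1 + t.1.2 + t.2) =
  \sum_(t <- box3 K | t.1.1 ^+ 2 + 2%:Z * t.1.2 ^+ 2 + 6%:Z * t.2 ^+ 2 == n%:Z)
     sgn (t.1.1 + t.1.2 + t.2) :> R.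
Proof.
move=> nK.
have bnd := hexagonal_box_bound nK.
pose even (x : int) := (2%:Z %| x)%Z.
rewrite (bigID (fun t => even t.2)) /= [X in _ + X](bigID (fun t => even t.1.2)) /=.
(* The new sign exponent [s - c + (b - c)] has the parity of [s + b], which differs from that of
   [s + b + c] because [c] is odd. *)
have -> : \sum_(t <- box3 K | (t.1.1 ^+ 2 + 2%:Z * (t.1.2 ^+ 2 - t.1.2 * t.2 + t.2 ^+ 2)
      == n%:Z) && ~~ even t.2 && even t.1.2) sgn (t.1.1 + t.1.2 + t.2) =
   - \sum_(t <- box3 K | (t.1.1 ^+ 2 + 2%:Z * (t.1.2 ^+ 2 - t.1.2 * t.2 + t.2 ^+ 2)
      == n%:Z) && ~~ even t.2 && ~~ even t.1.2) sgn (t.1.1 + t.1.2 + t.2) :> R.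
  rewrite -sumrN.
  apply: (eq_big_bij (h := fun t => (t.1.1, - t.2, t.1.2 - t.2))
                     (k := fun t => (t.1.1, t.2 - t.1.2, - t.1.2)));
    rewrite ?box3_uniq //.
  - case=> -[s b] c _ /=; rewrite mem_box3 => /andP[/andP[/eqP e hc] hb].
    have e' : s ^+ 2 + 2%:Z * ((- c) ^+ 2 - (- c) * (b - c) + (b - c) ^+ 2) = n%:Z.
      by rewrite -e; ring.
    rewrite (bnd _ _ _ e') e' eqxx; clear e e' bnd nK; rewrite /even in hb hc *; split=> //.
    + by lia.
    + by congr (_, _, _); lia.
    + by apply: sgnS; lia.
  - case=> -[s b] c _ /=; rewrite mem_box3 => /andP[/andP[/eqP e hc] hb].
    have e' : s ^+ 2 + 2%:Z * ((c - b) ^+ 2 - (c - b) * (- b) + (- b) ^+ 2) = n%:Z.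
      by rewrite -e; ring.
    rewrite (bnd _ _ _ e') e' eqxx; clear e e' bnd nK; rewrite /even in hb hc *; split=> //.
    + by lia.
    + by congr (_, _, _); lia.
rewrite addNr addr0.
(* For even [c] put [c = 2 y] and [b = x + y]; then [b^2 - b c + c^2 = x^2 + 3 y^2]. *)
apply: (eq_big_bij (h := fun t => (t.1.1, t.1.2 - (t.2 %/ 2%:Z)%Z, (t.2 %/ 2%:Z)%Z))
                   (k := fun t => (t.1.1, t.1.2 + t.2, 2%:Z * t.2)));
  rewrite ?box3_uniq //.
- case=> -[s b] c _ /=; set y := (c %/ _)%Z => /andP[/eqP e hc].
  have ce : c = 2%:Z * y by rewrite /even in hc; clear e; lia.
  have e' : s ^+ 2 + 2%:Z * (b - y) ^+ 2 + 6%:Z * y ^+ 2 = n%:Z by rewrite -e ce; ring.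
  rewrite mem_box3 e' eqxx ce; split=> //.
  + apply: (sum3_box_bound _ _ _ _ e'); rewrite ?absz_le_sqr //.
    * by clear -nK; lia.
    * by have := absz_le_sqr (b - y); clear; move: ((b - y) ^+ 2) => u; lia.
    * by have := absz_le_sqr y; clear; move: (y ^+ 2) => u; lia.
  + by congr (_, _, _); clear; lia.
  + by apply: sgnE; clear; lia.
- case=> -[s x] y _ /= /eqP e.
  have e' : s ^+ 2 + 2%:Z * ((x + y) ^+ 2 - (x + y) * (2%:Z * y) + (2%:Z * y) ^+ 2) = n%:Z.
    by rewrite -e; ring.
  rewrite mem_box3 (bnd _ _ _ e') e' eqxx; split=> //; first by rewrite /even; clear; lia.
  by congr (_, _, _); clear; lia.
Qed.

(** This is [phi(q) phi(-q) = phi(-q^2)^2]. Where [x + y] is odd, swapping [x] and [y] reverses the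
    sign and the terms cancel; where it is even, substitute [x = a + b] and [y = a - b]. *)
Lemma sum_two_squares (R : pzRingType) (K n : nat) : (n <= K)%N ->
  \sum_(t <- box2 K | t.1 ^+ 2 + t.2 ^+ 2 == n%:Z) sgn t.2 =
  \sum_(t <- box2 K |
    2%:Z * t.1 ^+ 2 + 2%:Z * t.2 ^+ 2 == n%:Z) sgn (t.1 + t.2) :> R.
Proof.
move=> nK; set s := box2 K; have us : uniq s := box2_uniq K.
have ms x y : ((x, y) \in s) = (`|x| <= K)%N && (`|y| <= K)%N := mem_box2 K x y.
pose even (x : int) := (2%:Z %| x)%Z.
rewrite (bigID (fun t => even (t.1 + t.2))) /= [X in _ + X](bigID (fun t => even t.2)) /=.
have -> : \sum_(t <- s | (t.1 ^+ 2 + t.2 ^+ 2 == n%:Z) && ~~ even (t.1 + t.2) && even t.2)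
      sgn t.2 =
   - \sum_(t <- s | (t.1 ^+ 2 + t.2 ^+ 2 == n%:Z) && ~~ even (t.1 + t.2) && ~~ even t.2)
      sgn t.2 :> R.
  rewrite -sumrN.
  apply: (eq_big_bij (h := fun t => (t.2, t.1)) (k := fun t => (t.2, t.1))) => //.
  - case=> x y; rewrite !ms /= => hb /andP[/andP[/eqP e h1] h2].
    rewrite addrC e eqxx; clear e; rewrite /even in h1 h2 *; split=> //; first by lia.
      by lia.
    by apply: sgnS; lia.
  - case=> x y; rewrite !ms /= => hb /andP[/andP[/eqP e h1] h2].
    by rewrite addrC e eqxx; clear e; rewrite /even in h1 h2 *; split=> //; lia.
rewrite addNr addr0.
apply: (eq_big_bij (h := fun t => (((t.1 + t.2) %/ 2%:Z)%Z, ((t.1 - t.2) %/ 2%:Z)%Z))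
                   (k := fun t => (t.1 + t.2, t.1 - t.2))) => //.
- case=> x y; rewrite !ms /= => hb /andP[/eqP e h1].
  set a := ((x + y) %/ _)%Z; set b := ((x - y) %/ _)%Z.
  have [xe ye] : x = a + b /\ y = a - b by clear e; rewrite /even in h1; lia.
  have e' : 2%:Z * a ^+ 2 + 2%:Z * b ^+ 2 = n%:Z by rewrite -e xe ye; ring.
  rewrite e' eqxx; split=> //.
  + by move: e'; have := absz_le_sqr a; have := absz_le_sqr b; move: (a ^+ 2) (b ^+ 2) => u v;
      clear -nK; lia.
  + by rewrite -xe -ye.
  + by apply: sgnE; clear; lia.
- case=> a b; rewrite !ms /= => hb /eqP e.
  have e' : (a + b) ^+ 2 + (a - b) ^+ 2 = n%:Z by rewrite -e; ring.
  rewrite e' eqxx; split.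
  + by move: e'; have := absz_le_sqr (a + b); have := absz_le_sqr (a - b);
      move: ((a + b) ^+ 2) ((a - b) ^+ 2) => u v; clear -nK; lia.
  + by rewrite /even; clear; lia.
  + by congr (_, _); clear; lia.
Qed.

(** * The triple product modulo ['X^N] *)

Section TruncatedCongruence.
Variable F : fieldType.
Implicit Types p q r : {poly F}.

Definition eqXn (N : nat) (p q : {poly F}) : bool := 'X^N %| p - q.

Lemma eqXnP N p q : reflect (forall i, (i < N)%N -> p`_i = q`_i) (eqXn N p q).
Proof.
apply: (iffP idP) => [/dvdpP[r e] i iN|h].
  by apply/eqP; rewrite -subr_eq0 -coefB e coefMXn iN.
rewrite /eqXn -[p - q](poly_take_drop N).
suff -> : take_poly N (p - q) = 0 by rewrite add0r dvdp_mull.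
apply/polyP => i; rewrite coef_take_poly coef0; case: ifP => // iN.
by rewrite coefB h // subrr.
Qed.

Lemma eqXn_refl N p : eqXn N p p. Proof. by apply/eqXnP. Qed.

Lemma eqXn_sym N p q : eqXn N p q -> eqXn N q p.
Proof. by rewrite /eqXn -opprB dvdpNr. Qed.

Lemma eqXn_trans N q p r : eqXn N p q -> eqXn N q r -> eqXn N p r.
Proof. by move=> /eqXnP h /eqXnP h'; apply/eqXnP => i iN; rewrite h // h'. Qed.

Lemma eqXnM N p q p' q' : eqXn N p p' -> eqXn N q q' -> eqXn N (p * q) (p' * q').
Proof.
rewrite /eqXn => h h'; have -> : p * q - p' * q' = (p - p') * q + p' * (q - q') by ring.
by apply: dvdp_add; [exact: dvdp_mulr | exact: dvdp_mull].
Qed.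

Lemma eqXnX N p q k : eqXn N p q -> eqXn N (p ^+ k) (q ^+ k).
Proof. by move=> h; elim: k => [|k IHk]; rewrite ?eqXn_refl // !exprS eqXnM. Qed.

Lemma eqXnS (I : Type) (s : seq I) (P : pred I) (f g : I -> {poly F}) N :
  (forall i, P i -> eqXn N (f i) (g i)) ->
  eqXn N (\sum_(i <- s | P i) f i) (\sum_(i <- s | P i) g i).
Proof.
move=> h; rewrite /eqXn -sumrB; elim/big_ind: _ => [||i /h //]; first exact: dvdp0.
exact: dvdp_add.
Qed.

Lemma eqXn_prod1 (I : eqType) (s : seq I) (f : I -> {poly F}) N :
  {in s, forall i, eqXn N (f i) 1} -> eqXn N (\prod_(i <- s) f i) 1.
Proof.
elim: s => [|x s IHs] h; rewrite ?big_nil ?eqXn_refl // big_cons.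
rewrite -[X in eqXn N _ X]mulr1; apply: eqXnM; first by rewrite h ?mem_head.
by apply: IHs => i si; rewrite h // in_cons si orbT.
Qed.

Lemma eqXnW M N p q : (M <= N)%N -> eqXn N p q -> eqXn M p q.
Proof. by move=> MN; apply: dvdp_trans; rewrite dvdp_exp2l. Qed.

Lemma eqXn_mulXn N k p q : eqXn N p q -> eqXn (k + N) ('X^k * p) ('X^k * q).
Proof. by rewrite /eqXn -mulrBr exprD; exact: dvdp_mul. Qed.

Lemma eqXn_cancel N r p q : r`_0 != 0 -> eqXn N (r * p) (r * q) -> eqXn N p q.
Proof.
move=> r0; rewrite /eqXn -mulrBr mulrC Gauss_dvdpl //; apply: coprimep_expl.
by rewrite coprimep_sym coprimepX rootE horner_coef0.
Qed.

Lemma eqXn_1DXn N (c : F) k : (N <= k)%N -> eqXn N (1 + c *: 'X^k) 1.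
Proof.
by move=> Nk; rewrite /eqXn addrAC subrr add0r -mul_polyC dvdp_mull // dvdp_exp2l.
Qed.
End TruncatedCongruence.

(** * Gaussian binomials and the q-binomial theorem *)

Section QBinomial.
Variables (R : comNzRingType) (q : R).

(** Gaussian binomial coefficient, given by a Pascal recurrence so that no division is required in
    [R]. *)
Fixpoint qbin (m j : nat) : R :=
  match m, j with
  | _, 0 => 1
  | 0, _.+1 => 0
  | m'.+1, j'.+1 => qbin m' j' + q ^+ j'.+1 * qbin m' j'.+1
  end.

Lemma qbin0 m : qbin m 0 = 1. Proof. by case: m. Qed.

Definition qpoch (m : nat) : R := \prod_(0 <= i < m) (1 - q ^+ i.+1).

Lemma qpochS m : qpoch m.+1 = qpoch m * (1 - q ^+ m.+1).
Proof. by rewrite /qpoch big_nat_recr. Qed.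

Lemma qpoch0 : qpoch 0 = 1.
Proof. by rewrite /qpoch big_geq. Qed.

Lemma qbin_small m j : (m < j)%N -> qbin m j = 0.
Proof.
elim: m j => [|m IHm] [|j] //= lt_mj.
by rewrite !IHm ?mulr0 ?addr0 // ltnW.
Qed.

(** The quotient formula cleared of denominators; the induction rests on [(1 - q^(j+1)) + q^(j+1) (1
    - q^(m-j)) = 1 - q^(m+1)]. *)
Lemma qbin_qpoch m j : (j <= m)%N -> qbin m j * (qpoch j * qpoch (m - j)) = qpoch m.
Proof.
elim: m j => [|m IHm] [|j]; rewrite ?subn0 ?qpoch0 ?mul1r //=; try by rewrite mul1r.
rewrite ltnS => le_jm; rewrite subSS mulrDl.
have -> : qbin m j * (qpoch j.+1 * qpoch (m - j)) = qpoch m * (1 - q ^+ j.+1).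
  by rewrite -(IHm j) // qpochS; ring.
have -> : q ^+ j.+1 * qbin m j.+1 * (qpoch j.+1 * qpoch (m - j))
    = q ^+ j.+1 * (qpoch m * (1 - q ^+ (m - j))).
  move: le_jm; rewrite leq_eqVlt => /predU1P[->|lt_jm].
    by rewrite qbin_small // subnn expr0 subrr; ring.
  by rewrite -(IHm j.+1) // -(subnSK lt_jm) (qpochS (m - j.+1)); ring.
have -> : qpoch m.+1 = qpoch m * (1 - q ^+ j.+1 * q ^+ (m - j)).
  by rewrite qpochS -exprD addSn subnKC.
ring.
Qed.

(** Splitting off the factor [i = 0] leaves the product for [x * q]. The homogeneous form in [x] and
    [y] avoids negative powers of [q] in the triple product. *)
Lemma qbinomial (x y : R) m :
  \prod_(0 <= i < m) (y + x * q ^+ i) =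
  \sum_(0 <= j < m.+1) q ^+ 'C(j, 2) * qbin m j * x ^+ j * y ^+ (m - j).
Proof.
elim: m x => [|m IHm] x; first by rewrite big_geq // big_nat1 /=; ring.
rewrite big_nat_recl // (eq_bigr (fun i => y + (x * q) * q ^+ i)); last first.
  by move=> i _; rewrite exprS mulrA.
rewrite IHm expr0 mulr1 mulrDl !big_distrr /=.
rewrite [X in X + _]big_nat_recl // [X in X + _ + _]/=.
rewrite [RHS]big_nat_recl //= -addrA; congr (_ + _).
  by rewrite ?qbin0 !subn0 exprS; ring.
have -> : \sum_(0 <= i < m) y * (q ^+ 'C(i.+1, 2) * qbin m i.+1 * (x * q) ^+ i.+1 * y ^+ (m - i.+1))
  = \sum_(0 <= i < m.+1) q ^+ 'C(i.+1, 2) * q ^+ i.+1 * qbin m i.+1 * x ^+ i.+1 * y ^+ (m - i).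
  rewrite [RHS]big_nat_recr //= qbin_small // mulr0 !mul0r addr0.
  apply: eq_big_nat => i /andP[_ lt_im]; rewrite -(subnSK lt_im) exprMn (exprS y); ring.
rewrite -big_split /=; apply: eq_big_nat => i _.
by rewrite exprMn binS bin1 subSS exprD !exprS; ring.
Qed.
End QBinomial.

(** Completes the square in the exponents of [qbinomial] for base ['X^2] and [y = 'X^(n.*2.-1)], up
    to a constant independent of [j]. *)
Lemma triple_exponent n j : (j <= n.*2)%N ->
  (j * j.-1 + n.*2.-1 * (n.*2 - j) = n * n.-1 + n * n.*2.-1 + absz (j%:Z - n%:Z)%R ^ 2)%N.
Proof.
case: (posnP n) => [-> | n0 le]; first by rewrite leqn0 => /eqP ->.
have pred k : ((k * k.-1)%N%:Z = k%:Z * k%:Z - k%:Z)%R by case: k => [|k] //; lia.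
have ea : (n.*2.-1%:Z = n%:Z + n%:Z - 1)%R by lia.
have eb : ((n.*2 - j)%N%:Z = n%:Z + n%:Z - j%:Z)%R by lia.
have ec : ((absz (j%:Z - n%:Z)%R)%:Z * (absz (j%:Z - n%:Z)%R)%:Z
    = (j%:Z - n%:Z) * (j%:Z - n%:Z))%R by clear; nia.
rewrite -mulnn; move: (pred n) (pred j) ea eb ec.
move: (n * n.-1)%N (j * j.-1)%N n.*2.-1 (n.*2 - j)%N (absz _) => p q a b c ep eq ea eb ec.
apply/eqP; rewrite -eqz_nat !PoszD !PoszM ep eq ea eb ec.
by apply/eqP; ring.
Qed.

(** * The finite triple product and its truncated limit *)

Section TripleProduct.
Variable F : fieldType.

(** Truncation of [phi(q^m)] for [z = 1] and of [phi(-q^m)] for [z = -1], as [x^2] and [x] have the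
    same parity. *)
Definition theta (K : nat) (z : F) (m : nat) : {poly F} :=
  \sum_(x <- box K) z ^+ `|x|%N *: 'X^(m * `|x| ^ 2).

Definition oddprod (n : nat) (z : F) : {poly F} :=
  \prod_(0 <= i < n) (1 + z *: 'X^(i.*2.+1)).

Lemma sign_expE (z : F) (a b : nat) : z ^+ 2 = 1 -> odd a = odd b -> z ^+ a = z ^+ b.
Proof.
move=> z2 e; rewrite -(odd_double_half a) -(odd_double_half b) e !exprD.
by rewrite -!muln2 !(mulnC _ 2) !exprM z2 !expr1n.
Qed.

Lemma prod_even_exp n : \prod_(0 <= i < n) 'X^(i.*2) = 'X^(n * n.-1) :> {poly F}.
Proof.
elim: n => [|n IHn]; first by rewrite big_geq.
by rewrite big_nat_recr //= IHn -exprD; congr ('X^_); case: n {IHn} => //= n; lia.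
Qed.

(** For [i < n] take [z X^(2 i)] out of the factor, using [1 / z = z]; for [i >= n] take out
    [X^(2 n - 1)]. Each half leaves one copy of [oddprod n z]. *)
Lemma oddprod_sqr n (z : F) : z ^+ 2 = 1 ->
  \prod_(0 <= i < n.*2) ('X^(n.*2.-1) + z%:P * 'X^2 ^+ i) =
  z ^+ n *: 'X^(n * n.-1 + n * n.*2.-1) * oddprod n z ^+ 2.
Proof.
move=> z2; rewrite -addnn (big_cat_nat _ (n := n)) //= ?leq_addr //.
have -> : \prod_(0 <= i < n) ('X^((n + n).-1) + z%:P * 'X^2 ^+ i) =
    z ^+ n *: 'X^(n * n.-1) * oddprod n z.
  rewrite big_nat_rev /= add0n -prod_even_exp [in RHS]big_nat_rev /= add0n.
  have -> : z ^+ n = \prod_(0 <= i < n) z by rewrite prodr_const_nat subn0.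
  rewrite -mul_polyC rmorph_prod -!big_split /=; apply: eq_big_nat => i /andP[_ lt_in].
  rewrite -exprM mul2n -!mul_polyC.
  have -> : (n + n).-1 = ((n - i.+1).*2 + i.*2.+1)%N by lia.
  by rewrite exprD mulrDr mulr1 mulrCA !mulrA -polyCM -expr2 z2 mul1r addrC;
    congr (_ + _); rewrite mulrC.
have -> : \prod_(n <= i < n + n) ('X^((n + n).-1) + z%:P * 'X^2 ^+ i) =
    'X^(n * (n + n).-1) * oddprod n z.
  rewrite -{1}[n]add0n big_addn addnK.
  have -> : 'X^(n * (n + n).-1) = \prod_(0 <= i < n) 'X^((n + n).-1) :> {poly F}.
    by rewrite prodr_const_nat subn0 -exprM mulnC.
  rewrite -big_split /=; apply: eq_big_nat => i /andP[_ lt_in].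
  rewrite -exprM mulrDr mulr1 -!mul_polyC; congr (_ + _); rewrite mulrCA -exprD.
  by congr (_ * 'X^_); lia.
by rewrite exprD -!mul_polyC; ring.
Qed.

(** The q-binomial theorem for [oddprod_sqr], with summation index [j = x + n] and the common power
    of ['X] cancelled. *)
Lemma finite_triple_product n (z : F) : z ^+ 2 = 1 ->
  oddprod n z ^+ 2 =
  \sum_(x <- box n) z ^+ `|x|%N *: 'X^(`|x| ^ 2) * qbin ('X^2 : {poly F}) n.*2 (absz (x + n%:Z)).
Proof.
move=> z2; have := oddprod_sqr n z2; rewrite qbinomial => e.
have z2' : z ^+ n * z ^+ n = 1 by rewrite -expr2 exprAC z2 expr1n.
have X0 : 'X^(n * n.-1 + n * n.*2.-1) != 0 :> {poly F} by rewrite expf_neq0 ?polyX_eq0.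
apply: (mulfI X0).
transitivity (z ^+ n *: (z ^+ n *: 'X^(n * n.-1 + n * n.*2.-1) * oddprod n z ^+ 2)).
  by rewrite -scalerAl scalerA z2' scale1r.
rewrite -{}e scaler_sumr big_distrr /= /box big_map /index_iota subn0.
rewrite big_seq [RHS]big_seq; apply: eq_bigr => j; rewrite mem_iota add0n => /andP[_ lt_j].
rewrite subrK absz_nat.
have -> : z ^+ `|j%:Z - n%:Z|%N = z ^+ n * z ^+ j by rewrite -exprD; apply: sign_expE => //; lia.
have e2 : ('C(j, 2) * 2 = j * j.-1)%N by rewrite -[2%N in LHS]/(2`!)%N bin_ffact ffactnS ffactn1.
have eX : 'X^2 ^+ 'C(j, 2) * 'X^(n.*2.-1) ^+ (n.*2 - j) =
   'X^(n * n.-1 + n * n.*2.-1) * 'X^(`|j%:Z - n%:Z| ^ 2) :> {poly F}.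
  by rewrite -!exprM -!exprD mulnC e2 triple_exponent // -ltnS.
rewrite -!mul_polyC polyCM !rmorphXn /=.
transitivity (z%:P ^+ n * z%:P ^+ j *
  ('X^2 ^+ 'C(j, 2) * 'X^(n.*2.-1) ^+ (n.*2 - j)) * qbin 'X^2 n.*2 j).
  ring.
by rewrite eX; ring.
Qed.

Lemma qpoch_eqXn a b : (a <= b)%N ->
  eqXn a.*2.+2 (qpoch ('X^2 : {poly F}) a) (qpoch ('X^2 : {poly F}) b).
Proof.
move=> ab; rewrite /qpoch (big_cat_nat _ (n := a) (p := b)) //= -[X in eqXn _ X]mulr1.
apply: eqXnM; first exact: eqXn_refl.
apply/eqXn_sym/eqXn_prod1 => i; rewrite mem_index_iota => /andP[ai _].
by rewrite -exprM -scaleN1r; apply: eqXn_1DXn; lia.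
Qed.

(** The Jacobi triple product for [z = 1] and [z = -1]: in each term of the finite identity, the two
    Pochhammer symbols in the denominator of the Gaussian binomial are replaced by
    [qpoch 'X^2 K]. *)
Lemma theta_oddprod K (z : F) : z ^+ 2 = 1 ->
  eqXn K.*2 (qpoch 'X^2 K.*2 * theta K z 1) (qpoch 'X^2 K ^+ 2 * oddprod K z ^+ 2).
Proof.
move=> z2; rewrite finite_triple_product // /theta !big_distrr /=.
rewrite big_seq [X in eqXn _ _ X]big_seq; apply: eqXnS => /= x; rewrite mem_box => xK.
rewrite mul1n; set j := absz (x + K%:Z); set k := `|x|%N.
have jle : (j <= K.*2)%N by lia.
rewrite -(qbin_qpoch _ jle) -!mul_polyC.
set q := qbin _ _ _; set c := (z ^+ k)%:P.
have ej : eqXn (K - k).*2.+2 (qpoch 'X^2 j) (qpoch ('X^2 : {poly F}) K).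
  have [le|/ltnW le] := leqP j K.
    by apply: eqXnW (qpoch_eqXn le); lia.
  by apply/eqXn_sym; apply: eqXnW (qpoch_eqXn le); lia.
have ej' : eqXn (K - k).*2.+2 (qpoch 'X^2 (K.*2 - j)) (qpoch ('X^2 : {poly F}) K).
  have [le|/ltnW le] := leqP (K.*2 - j) K.
    by apply: eqXnW (qpoch_eqXn le); lia.
  by apply/eqXn_sym; apply: eqXnW (qpoch_eqXn le); lia.
have := eqXn_mulXn (k ^ 2) (eqXnM (eqXn_refl _ (q * c)) (eqXnM ej ej')).
(* The replacement is exact only to order [2 (K - k) + 2], but the factor [X^(k^2)] makes up the
   loss, since [k^2 - 2 k + 2 >= 0]. *)
have le2 : (K.*2 <= k ^ 2 + (K - k).*2.+2)%N by clear; nia.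
move/(eqXnW le2); rewrite -expr2.
by congr (eqXn _ _ _); ring.
Qed.

Lemma coef_theta2 K (z1 z2 : F) m1 m2 n :
  (theta K z1 m1 * theta K z2 m2)`_n =
  \sum_(t <- box2 K | m1%:Z * t.1 ^+ 2 + m2%:Z * t.2 ^+ 2 == n%:Z)
     z1 ^+ `|t.1|%N * z2 ^+ `|t.2|%N.
Proof.
rewrite big_mkcond big_allpairs_dep /= /theta mulr_suml coef_sum; apply: eq_bigr => x _.
rewrite mulr_sumr coef_sum; apply: eq_bigr => y _.
rewrite -scalerAl -scalerAr scalerA -exprD coefZ coefXn mulr_natr mulrb.
have -> : (n == m1 * `|x| ^ 2 + m2 * `|y| ^ 2)%N = (m1%:Z * x ^+ 2 + m2%:Z * y ^+ 2 == n%:Z).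
  by rewrite -!abszX -eqz_nat eq_sym PoszD !PoszM !abszE !normrX !real_normK ?num_real.
by [].
Qed.

Lemma coef_theta3 K (z1 z2 z3 : F) m1 m2 m3 n :
  (theta K z1 m1 * theta K z2 m2 * theta K z3 m3)`_n =
  \sum_(t <- box3 K | m1%:Z * t.1.1 ^+ 2 + m2%:Z * t.1.2 ^+ 2 + m3%:Z * t.2 ^+ 2 == n%:Z)
     z1 ^+ `|t.1.1|%N * z2 ^+ `|t.1.2|%N * z3 ^+ `|t.2|%N.
Proof.
rewrite big_mkcond big_allpairs_dep big_allpairs_dep /= {1 2}/theta !mulr_suml coef_sum.
apply: eq_bigr => x _; rewrite -mulrA mulr_suml mulr_sumr coef_sum; apply: eq_bigr => y _.
rewrite mulrA /theta mulr_sumr coef_sum; apply: eq_bigr => z _.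
rewrite -!(scalerAl, scalerAr) !scalerA -!exprD coefZ coefXn mulr_natr mulrb.
have -> : (n == m1 * `|x| ^ 2 + m2 * `|y| ^ 2 + m3 * `|z| ^ 2)%N =
    (m1%:Z * x ^+ 2 + m2%:Z * y ^+ 2 + m3%:Z * z ^+ 2 == n%:Z).
  by rewrite -!abszX -eqz_nat eq_sym !PoszD !PoszM !abszE !normrX !real_normK ?num_real.
by case: ifP => // _; ring.
Qed.
End TripleProduct.

(** * Reduction modulo 3 *)

Section GeneratingFunction.
Variables (F : fieldType) (ok : pred nat) (N : nat).

Definition partX (d : nat) : {poly F} := if ok d then 'X^d else 0.

(** By [genf_prod], a truncation of the product of [1 + q^e] over admissible [e < d], divided by
    that of [1 - q^e] over admissible [e <= d]. *)
Definition genf (d : nat) : {poly F} := \poly_(n < N) (num_after ok d n)%:R.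

Lemma genf_rec d :
  eqXn N (genf d.+1 * (1 - partX d.+1)) (genf d * (1 + (if (0 < d)%N then partX d else 0))).
Proof.
suff : eqXn N (genf d.+1) (genf d + (if (0 < d)%N then partX d else 0) * genf d
    + partX d.+1 * genf d.+1).
  by rewrite /eqXn; congr (_ %| _); ring.
have cX p n e : (n < N)%N -> (partX e * \poly_(i < N) (p i)%:R)`_n =
    (if (e <= n)%N && ok e then p (n - e)%N else 0%N)%:R.
  move=> nN; rewrite /partX; case: (ok e); last by rewrite mul0r coef0 andbF.
  rewrite coefXnM coef_poly andbT ; case: (leqP e n) => //= _.
  by rewrite (leq_ltn_trans (leq_subr _ _) nN).
apply/eqXnP => n nN; rewrite !coefD {1 2}/genf !coef_poly nN num_after_rec !natrD cX //.
congr (_ + _ + _); case: (posnP d) => [-> | d0] /=; first by rewrite mul0r coef0.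
by rewrite cX.
Qed.

Lemma genf_prod D :
  eqXn N (genf D * \prod_(1 <= d < D.+1) (1 - partX d)) (\prod_(1 <= d < D) (1 + partX d)).
Proof.
elim: D => [|D IHD].
  rewrite !big_geq // mulr1; apply/eqXnP => i iN.
  by rewrite coef_poly iN num_after_0l coef1.
have -> : \prod_(1 <= d < D.+1) (1 + partX d) =
    \prod_(1 <= d < D) (1 + partX d) * (1 + (if (0 < D)%N then partX D else 0)).
  case: (posnP D) => [-> | D0]; first by rewrite !big_geq // addr0 mulr1.
  by rewrite big_nat_recr.
rewrite big_nat_recr //= mulrC -mulrA [_ * genf _]mulrC.
apply: eqXn_trans (eqXnM (eqXn_refl _ _) (genf_rec D)) _.
rewrite mulrCA mulrA; apply: eqXnM (eqXn_refl _ _); exact: IHD.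
Qed.
End GeneratingFunction.

(** * Frobenius and extraction of exponents over the field with three elements *)

Section ModThree.
Local Notation F := 'F_3.
Local Notation P := {poly F}.

Lemma F3_three : 3%:R = 0 :> F. Proof. exact/eqP. Qed.

Lemma F3_cube (c : F) : c ^+ 3 = c.
Proof. by rewrite -[RHS]expf_card card_Fp. Qed.

Lemma cubeD (p q : P) : (p + q) ^+ 3 = p ^+ 3 + q ^+ 3.
Proof.
have p3 : 3%:R = 0 :> P by rewrite -polyC_natr F3_three.
transitivity (p ^+ 3 + q ^+ 3 + 3%:R * (p ^+ 2 * q + p * q ^+ 2)); first by ring.
by rewrite p3 mul0r addr0.
Qed.

Lemma cube_sum (I : Type) (s : seq I) (f : I -> P) :
  (\sum_(i <- s) f i) ^+ 3 = \sum_(i <- s) f i ^+ 3.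
Proof. by apply: (big_morph (fun p => p ^+ 3) cubeD); rewrite expr0n. Qed.

Lemma cube_monomial (c : F) a : (c *: 'X^a : P) ^+ 3 = c *: 'X^(3 * a).
Proof. by rewrite exprZn F3_cube -exprM mulnC. Qed.

Lemma theta_cube K (z : F) m : theta K z m ^+ 3 = theta K z (3 * m).
Proof.
by rewrite /theta cube_sum; apply: eq_bigr => x _; rewrite cube_monomial mulnA.
Qed.

(** The Atkin operator [U_3]; the bound [size p] loses nothing, since [3 i >= i]. *)
Definition U3 (p : P) : P := \poly_(i < size p) p`_(3 * i).

Lemma coef_U3 p i : (U3 p)`_i = p`_(3 * i).
Proof.
rewrite coef_poly; case: ltnP => // le; rewrite nth_default //.
by rewrite (leq_trans le) // leq_pmull.
Qed.

Lemma U3_eqXn M p q : eqXn (3 * M) p q -> eqXn M (U3 p) (U3 q).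
Proof.
move/eqXnP => h; apply/eqXnP => i iM; rewrite !coef_U3 h //.
by rewrite ltn_mul2l.
Qed.

(** By Frobenius [b^3] is [b(q^3)], which involves only exponents divisible by 3 and so factors out
    of the extraction. *)
Lemma U3_mul_cube a b : U3 (a * b ^+ 3) = U3 a * b.
Proof.
rewrite -[b]coefK poly_def cube_sum.
apply/polyP => n; rewrite coef_U3 !mulr_sumr !coef_sum; apply: eq_bigr => i _.
rewrite cube_monomial -!scalerAr !coefZ !coefMXn ltn_mul2l /= coef_U3.
by rewrite mulnBr.
Qed.

Lemma oddprod_exp9 K (z : F) :
  oddprod K z ^+ 9 = \prod_(0 <= i < K) (1 + z *: 'X^(9 * i.*2.+1)) :> P.
Proof.
rewrite /oddprod -prodrXl; apply: eq_bigr => i _.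
rewrite (exprM _ 3 3) cubeD cubeD !expr1n !cube_monomial !mulnA.
by [].
Qed.

Definition ok29 (d : nat) : bool := ~~ (2 %| d)%N && ~~ (9 %| d)%N.

Lemma ok29_add d K : ok29 (d + 18 * K) = ok29 d.
Proof.
have [h2 h9] : (2 %| 18 * K)%N /\ (9 %| 18 * K)%N by rewrite !dvdn_mulr.
by rewrite /ok29 (dvdn_addl _ h2) (dvdn_addl _ h9).
Qed.

(** The ninth power of [oddprod] is the product over odd multiples of 9, exactly the odd exponents
    that [ok29] omits. The induction adds a block of 18 exponents at a time, the period of
    [ok29]. *)
Lemma prod_partX K (z : F) :
  \prod_(0 <= d < 18 * K) (1 + z *: partX F ok29 d) * oddprod K z ^+ 9 = oddprod (9 * K) z.
Proof.
rewrite oddprod_exp9 /oddprod.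
elim: K => [|K IHK]; first by rewrite !big_geq // mulr1.
have [le18 le9] : (18 * K <= 18 * K.+1)%N /\ (9 * K <= 9 * K.+1)%N by lia.
rewrite (big_cat_nat (leq0n _) le18) [RHS](big_cat_nat (leq0n _) le9).
rewrite [X in _ * X = _]big_nat_recr //= -IHK.
have <- : \prod_(18 * K <= d < 18 * K.+1) (1 + z *: partX F ok29 d) * (1 + z *: 'X^(9 * K.*2.+1))
   = \prod_(9 * K <= i < 9 * K.+1) (1 + z *: 'X^(i.*2.+1)) :> P.
  rewrite -{1}[(18 * K)%N]add0n -{1}[(9 * K)%N]add0n !big_addn -!mulnBr subSnn !muln1.
  have -> : (9 * K.*2.+1 = 9 + 18 * K)%N by lia.
  pose f a : P := 1 + z *: 'X^(a + 18 * K).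
  rewrite (eq_bigr (fun d => if ok29 d then f d else 1)); last first.
    by move=> d _; rewrite /partX ok29_add; case: (ok29 d); rewrite // scaler0 addr0.
  rewrite [RHS](eq_bigr (fun i => f i.*2.+1)); last first.
    by move=> d _; rewrite /f; congr (1 + _ *: 'X^_); lia.
  rewrite -/(f 9%N) unlock /=; ring.
ring.
Qed.

Lemma oddprod_eqXn K L (z : F) : (K <= L)%N -> eqXn K.*2 (oddprod L z) (oddprod K z).
Proof.
move=> KL; rewrite /oddprod (big_cat_nat _ (n := K) (p := L)) //= -[X in eqXn _ _ X]mulr1.
apply: eqXnM; first exact: eqXn_refl.
apply: eqXn_prod1 => i; rewrite mem_index_iota => /andP[Ki _].
by apply: eqXn_1DXn; rewrite leqW // leq_double.
Qed.
End ModThree.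

(** [eqXn 1 r 1] encodes constant term 1, a form of invertibility that passes to products and
    powers. *)
Lemma eqXn_cancel1 (F : fieldType) N (r p q : {poly F}) :
  eqXn 1 r 1 -> eqXn N (r * p) (r * q) -> eqXn N p q.
Proof. by move/eqXnP/(_ 0%N isT); rewrite coef1 => r0; apply: eqXn_cancel; rewrite r0 oner_eq0. Qed.

Lemma eqXn1M (F : fieldType) N (p q : {poly F}) : eqXn N p 1 -> eqXn N q 1 -> eqXn N (p * q) 1.
Proof. by move=> h h'; rewrite -[1]mulr1; apply: eqXnM. Qed.

Lemma eqXn1X (F : fieldType) N (p : {poly F}) k : eqXn N p 1 -> eqXn N (p ^+ k) 1.
Proof. by move=> h; rewrite -(expr1n _ k); apply: eqXnX. Qed.

Lemma oddprod_unit (F : fieldType) K (z : F) : eqXn 1 (oddprod K z) 1.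
Proof. by apply: eqXn_prod1 => i _; apply: eqXn_1DXn. Qed.

Lemma qpoch_unit (F : fieldType) m : eqXn 1 (qpoch ('X^2 : {poly F}) m) 1.
Proof. by apply: eqXn_prod1 => i _; rewrite -exprM -scaleN1r; apply: eqXn_1DXn. Qed.

Lemma theta_unit (F : fieldType) K (z : F) : (0 < K)%N -> z ^+ 2 = 1 -> eqXn 1 (theta K z 1) 1.
Proof.
move=> K0 z2; apply: (eqXn_cancel1 (qpoch_unit F K.*2)).
have le : (1 <= K.*2)%N by rewrite double_gt0.
apply: eqXn_trans (eqXnW le (theta_oddprod K z2)) _; rewrite mulr1.
apply: eqXn_trans (eqXn1M (eqXn1X _ (qpoch_unit _ _)) (eqXn1X _ (oddprod_unit _ _))) _.
exact/eqXn_sym/qpoch_unit.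
Qed.

(** * The generating function in terms of theta series modulo 3 *)

Section Congruences.
Variable M : nat.
Hypothesis M_gt0 : (0 < M)%N.
Local Notation F := 'F_3.
(** [U3] divides the precision by 3, so precision [M] at the end requires [3 * M] before the
    extraction. *)
Let K := (3 * M)%N.
Let phi : {poly F} := theta K 1 1.
Let phim : {poly F} := theta K (-1) 1.

(** The bound [18 * K] fills whole blocks of [prod_partX] and is itself not an admissible part. *)
Let C := genf F ok29 K (18 * K).

Let K_gt0 : (0 < K)%N. Proof. by rewrite muln_gt0. Qed.

(** With [P z] the product of [1 + z q^d] over admissible [d], [C = P 1 / P (-1)], while
    [prod_partX] gives [P z = oddprod z ^ (-8)]. *)
Lemma genf_oddprod : eqXn K (C * oddprod K 1 ^+ 8) (oddprod K (-1) ^+ 8).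
Proof.
pose w := partX F ok29; pose P z := \prod_(0 <= d < 18 * K) (1 + z *: w d).
have h1 : eqXn K (C * P (-1)) (P 1).
  have := genf_prod F ok29 K (18 * K); rewrite -/C.
  have K18 : (0 < 18 * K)%N by rewrite muln_gt0 K_gt0.
  have w0 : w 0%N = 0 by [].
  have w18 : w (18 * K)%N = 0 by rewrite /w /partX -[(18 * K)%N]add0n ok29_add.
  rewrite big_nat_recr //= -/w w18 subr0 mulr1 /P.
  rewrite [X in _ -> eqXn _ (_ * X) _]big_ltn // [X in _ -> eqXn _ _ X]big_ltn // w0.
  rewrite !scaler0 !addr0 !mul1r.
  congr (eqXn _ (_ * _) _); apply: eq_bigr => d _; first by rewrite scaleN1r.
  by rewrite scale1r.
have hQ z : eqXn K (P z * oddprod K z ^+ 9) (oddprod K z).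
  rewrite prod_partX; apply: eqXnW (oddprod_eqXn z _); first by rewrite -addnn leq_addr.
  by rewrite leq_pmull.
move: h1 (hQ 1) (hQ (-1)) => h1 hp hm.
have u : eqXn 1 (oddprod K 1 * oddprod K (-1) : {poly F}) 1.
  by apply: eqXn1M; exact: oddprod_unit.
apply: (eqXn_cancel1 u); move: h1 hp hm.
move: (oddprod K 1) (oddprod K (-1)) (P 1) (P (-1)) => q r s t h1 hp hm.
apply: (@eqXn_trans _ _ (C * t * (r ^+ 9 * q ^+ 9))).
  have := eqXnM (eqXn_refl K (C * q ^+ 9)) (eqXn_sym hm).
  by congr (eqXn _ _ _); ring.
apply: eqXn_trans (eqXnM h1 (eqXn_refl _ _)) _.
have := eqXnM (eqXn_refl K (r ^+ 9)) hp.
by congr (eqXn _ _ _); ring.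
Qed.

(** Take fourth powers in the triple product for [z = 1] and [z = -1]; the Pochhammer factors are
    the same for both and cancel. *)
Lemma genf_theta : eqXn K (C * phi ^+ 4) (phim ^+ 4).
Proof.
have leK : (K <= K.*2)%N by rewrite -addnn leq_addr.
have hp := eqXnW leK (theta_oddprod K (expr1n F 2)).
have hm := eqXnW leK (theta_oddprod K (sqrr_sign F 1)).
apply: (eqXn_cancel1 (eqXn1X 4 (qpoch_unit F K.*2))).
move: genf_oddprod hp hm; rewrite -/phi -/phim.
move: (qpoch _ K.*2) (qpoch _ K) (oddprod K 1) (oddprod K (-1)) => a b q r h hp hm.
apply: (@eqXn_trans _ _ (b ^+ 8 * (C * q ^+ 8))).
  have := eqXnM (eqXn_refl K C) (eqXnX 4 hp).
  by congr (eqXn _ _ _); ring.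
apply: eqXn_trans (eqXnM (eqXn_refl _ _) h) _.
have := eqXnX 4 (eqXn_sym hm).
by congr (eqXn _ _ _); ring.
Qed.

Lemma theta_mul_signed : eqXn K (phi * phim) (theta K (-1) 2 ^+ 2).
Proof.
apply/eqXnP => n nK; rewrite expr2 !coef_theta2.
have := sum_two_squares F (ltnW nK).
rewrite (eq_bigl (fun t => 1%:Z * t.1 ^+ 2 + 1%:Z * t.2 ^+ 2 == n%:Z)); last first.
  by move=> t; rewrite !mul1r.
rewrite (eq_bigr (fun t => 1 ^+ `|t.1|%N * (-1) ^+ `|t.2|%N)); last first.
  by move=> t _; rewrite expr1n mul1r.
by move=> ->; apply: eq_bigr => t _; rewrite -sgnM.
Qed.

Lemma U3_theta : eqXn M (U3 (phim * phi * phi)) (phim * theta K (-1) 2 * theta K (-1) 6).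
Proof.
apply/eqXnP => n nM; rewrite coef_U3 !coef_theta3.
have le : (3 * n <= K)%N by rewrite leq_mul2l ltnW.
transitivity (\sum_(t <- box3 K | t.1.1 ^+ 2 + t.1.2 ^+ 2 + t.2 ^+ 2 == (3 * n)%:Z) sgn t.1.1 : F).
  apply: eq_big => t; first by rewrite !mul1r.
  by rewrite !expr1n !mulr1.
rewrite sum_three_squares_split ?F3_three // sum_three_squares_lattice //.
rewrite sum_hexagonal_lattice //; apply: eq_big => t; first by rewrite mul1r.
by rewrite -!sgnM.
Qed.

(** Multiplying [genf_theta] by [phi^2] turns the left side into [C] times a cube and the right side
    into [phim * phi * phi] times a cube, so that [U3_mul_cube] applies to both. *)
Lemma U3_genf : eqXn M (U3 C) (phim * theta K (-1) 3).
Proof.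
have u : eqXn 1 (phi ^+ 2) 1 by apply/eqXn1X/theta_unit; rewrite ?K_gt0 ?expr1n.
apply: (eqXn_cancel1 u).
have /U3_eqXn : eqXn K (C * (phi ^+ 2) ^+ 3) (phim * phi * phi * phim ^+ 3).
  have := eqXnM genf_theta (eqXn_refl K (phi ^+ 2)).
  by congr (eqXn _ _ _); ring.
rewrite !U3_mul_cube => h; rewrite mulrC; apply: eqXn_trans h _.
apply: eqXn_trans (eqXnM U3_theta (eqXn_refl _ _)) _.
have -> : theta K (-1) 3 = phim ^+ 3 :> {poly F} by rewrite theta_cube.
have -> : theta K (-1) 6 = theta K (-1) 2 ^+ 3 :> {poly F} by rewrite theta_cube.
have leM : (M <= K)%N by rewrite leq_pmull.
(* The right side is now [phim^2] times the fourth power of [theta K (-1) 2], that is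
   [phim^4 * phi^2]. *)
have := eqXnM (eqXn_refl M (phim ^+ 2)) (eqXnX 2 (eqXn_sym (eqXnW leM theta_mul_signed))).
by congr (eqXn _ _ _); ring.
Qed.
End Congruences.

(* The right-hand side is the coefficient of [q ^ m] in [phi(-q) phi(-q^3)]. *)
Lemma num_overpart29_mod3 m :
  (num_overpart 2 9 (3 * m))%:R =
  \sum_(t <- box2 (3 * m.+1) | t.1 ^+ 2 + 3%:Z * t.2 ^+ 2 == m%:Z) sgn (t.1 + t.2) :> 'F_3.
Proof.
(* Precision [m.+1] is the least that reaches the coefficient of degree [m]. *)
have := U3_genf (ltn0Sn m) => /eqXnP/(_ m (ltnSn m)).
rewrite coef_U3 coef_poly ltn_mul2l ltnSn /= -num_overpartE; last by lia.
move=> ->; rewrite coef_theta2; apply: eq_big => t; first by rewrite mul1r.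
by rewrite -sgnM.
Qed.

(** * Primes inert in [Z[sqrt(-3)]] *)

(** If [y] were nonzero modulo [p], [x / y] would be a square root of -3 and yield a nontrivial cube
    root of unity, which is impossible for [p = 2] modulo 3. *)
Lemma inert_dvd_norm (p : nat) (x y : int) : prime p -> (4 < p)%N -> (p %% 3 = 2)%N ->
  (p %| x ^+ 2 + 3%:Z * y ^+ 2)%Z -> (p %| x)%Z /\ (p %| y)%Z.
Proof.
move=> p_pr p_gt4 p_mod3.
have dvd12 : (p %| 12)%N -> (p = 5 \/ p = 8 \/ p = 11)%N.
  by move/(@dvdn_leq p 12 isT); lia.
have pc : p \in [pchar 'F_p]%R by exact: pchar_Fp.
have dE (z : int) : (p %| z)%Z = (z%:~R == 0 :> 'F_p)%R.
  case: z => n; first by rewrite -pmulrn -(dvdn_pcharf pc) /dvdz /=.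
  by rewrite NegzE mulrNz oppr_eq0 -pmulrn -(dvdn_pcharf pc) rpredN.
rewrite !dE rmorphD rmorphM !rmorphXn /=.
set a := (x%:~R)%R; set b := (y%:~R)%R; rewrite addr_eq0 => /eqP ha.
have n12 : (12%:R != 0 :> 'F_p)%R.
  rewrite -(dvdn_pcharf pc); apply/negP => h.
  by case: (dvd12 h) => [e|[e|e]]; move: h; rewrite e.
have [b0|b0] := eqVneq b 0%R.
  by move: ha; rewrite b0 expr0n mulr0 oppr0 => /eqP; rewrite expf_eq0 /= => ->.
(* With [a / b] a square root of -3, [u / v = (-1 + a / b) / 2] is a cube root of unity. *)
pose u := (a - b)%R; pose v := (2%:R * b)%R.
have n2 : (2%:R != 0 :> 'F_p)%R.
  by apply: contraNneq n12 => h; rewrite (_ : 12 = 2 * 6)%N // natrM h mul0r.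
have uv : (u ^+ 3 = v ^+ 3)%R.
  have -> : (u ^+ 3 = a ^+ 2 * a - 3%:R * a ^+ 2 * b + 3%:R * a * b ^+ 2 - b ^+ 3)%R.
    by rewrite /u; ring.
  by rewrite ha /v; ring.
have v0 : v != 0%R by rewrite mulf_neq0.
have u0 : u != 0%R.
  apply: contra_neq v0 => u0; apply/eqP.
  by rewrite -[v == 0](expf_eq0 v 3) -uv u0 expr0n.
have := divn_eq p 3; rewrite p_mod3; set k := (p %/ 3)%N => pk.
(* With [p = 3 k + 2], Fermat gives [w (w^3)^k = 1], so a nonzero [w] is determined by its cube. *)
have fermat (w : 'F_p) : w != 0%R -> (w * (w ^+ 3) ^+ k = 1)%R.
  move=> w0; apply: (mulfI w0); rewrite mulr1.
  transitivity (w ^+ (k * 3 + 2)); first by rewrite -exprM mulnC addn2 !exprS.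
  by rewrite -pk -[RHS]expf_card card_Fp.
have e : u = v.
  have f3 : ((u ^+ 3) ^+ k != 0)%R by rewrite !expf_neq0.
  by apply: (mulIf f3); rewrite fermat // uv fermat.
have a3 : a = (3%:R * b)%R by move: e; rewrite /u /v => e; rewrite -[a](subrK b) e; ring.
(* Now [a = 3 b], so [a^2 + 3 b^2 = 0] becomes [12 b^2 = 0]. *)
have : (12%:R * b ^+ 2 = 0 :> 'F_p)%R.
  by apply/eqP; rewrite -(subr0 (_ * _)%R) -(subrr (a ^+ 2)) {2}ha a3; apply/eqP; ring.
by move/eqP; rewrite mulf_eq0 (negPf n12) expf_eq0 /= (negPf b0).
Qed.

Lemma norm_descent (p : nat) (m x y : int) : prime p -> (4 < p)%N -> (p %% 3 = 2)%N ->
  (x ^+ 2 + 3%:Z * y ^+ 2 = p%:Z ^+ 2 * m)%R ->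
  exists x' y' : int, (x' ^+ 2 + 3%:Z * y' ^+ 2 = m)%R.
Proof.
move=> p_pr p_gt4 p_mod3 e.
have [] := @inert_dvd_norm p x y p_pr p_gt4 p_mod3.
  by rewrite e expr2 -mulrA dvdz_mulr.
case/dvdzP=> x' xe /dvdzP[y' ye]; exists x', y'.
have p0 : p%:Z ^+ 2 != 0 by rewrite expf_neq0 // eqz_nat; lia.
by apply: (mulfI p0); rewrite -e xe ye; ring.
Qed.

Lemma norm_descent_prod (p : nat -> nat) (k : nat) (m x y : int) :
  (forall i, (1 <= i <= k)%N -> [/\ prime (p i), 4 < p i & p i %% 3 = 2]%N) ->
  x ^+ 2 + 3%:Z * y ^+ 2 = (\prod_(1 <= i < k.+1) p i ^ 2)%N%:Z * m ->
  exists x' y' : int, x' ^+ 2 + 3%:Z * y' ^+ 2 = m.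
Proof.
elim: k m x y => [|k IHk] m x y hp.
  by rewrite big_geq // mul1r => e; exists x, y.
rewrite big_nat_recr //= PoszM -mulrA => /IHk[i /andP[i1 ik]|x' [y']].
  by apply: hp; rewrite i1 leqW.
have [pr gt4 mod3] : [/\ prime (p k.+1), 4 < p k.+1 & p k.+1 %% 3 = 2]%N.
  by apply: hp; rewrite leqnn.
by rewrite -mulnn PoszM -expr2; exact: norm_descent.
Qed.

Lemma prime_mod6_mod3 (p : nat) : prime p -> (5 <= p)%N -> (p <> 1 %[mod 6])%N -> (p %% 3 = 2)%N.
Proof.
move=> p_pr p5 p1; have n2 : ~~ (2 %| p)%N.
  by rewrite dvdn_prime2 //; apply/eqP => e; rewrite -e in p5.
have n3 : ~~ (3 %| p)%N by rewrite dvdn_prime2 //; apply/eqP => e; rewrite -e in p5.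
lia.
Qed.

Lemma num_overpart29_eq0 (m : nat) :
  (forall x y : int, x ^+ 2 + 3%:Z * y ^+ 2 <> m%:Z) -> (num_overpart 2 9 (3 * m) = 0 %[mod 3])%N.
Proof.
move=> no_rep; rewrite mod0n; apply/eqP; rewrite -/(dvdn 3 _).
rewrite (dvdn_pcharf (pchar_Fp (isT : prime 3))) num_overpart29_mod3.
by rewrite big1_seq // => t /andP[/eqP /no_rep].
Qed.

Local Close Scope ring_scope.

Theorem theorem3p8 (k n : nat) (p : nat -> nat)
  (p_prime : forall i, 1 <= i <= k.+1 -> prime (p i))
  (p_ge5 : forall i, 1 <= i <= k.+1 -> 5 <= p i)
  (p_mod6 : forall i, 1 <= i <= k.+1 -> p i <> 1 %[mod 6])
  (j : int) (hj : (j <> 0 %[mod p k.+1])%Z) :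
  Bbar 2 9 (18%:Z * (\prod_(1 <= i < k.+2) p i ^ 2)%N%:Z * n%:Z
            + 3%:Z * (6%:Z * j + (p k.+1)%:Z)
              * (\prod_(1 <= i < k.+1) p i ^ 2)%N%:Z * (p k.+1)%:Z)%R
    = 0 %[mod 3].
Proof.
have hp i : 1 <= i <= k.+1 -> [/\ prime (p i), 4 < p i & p i %% 3 = 2].
  by move=> hi; split; [exact: p_prime | exact: p_ge5 | apply: prime_mod6_mod3; auto].
set P := \prod_(1 <= i < k.+1) _; set q := p k.+1.
(* The argument of [Bbar] factors as [3 P q t]; since [q] does not divide [t], the prime [q] divides
   [q t] exactly once. *)
pose t : int := (6%:Z * (q%:Z * n%:Z + j) + q%:Z)%R.
have [q_pr q_gt4 q_mod3] : [/\ prime q, 4 < q & q %% 3 = 2] by apply: hp; rewrite leqnn.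
have q_ndvd_t : ~~ (q %| t)%Z.
  have q6 : coprimez q 6%:Z.
    rewrite coprimezE /= prime_coprime //; apply/negP => q6; have le6 := @dvdn_leq q 6 isT q6.
    have q5 : q = 5 by clear -le6 q_gt4 q_mod3; move: q le6 q_gt4 q_mod3 => r; lia.
    by rewrite q5 in q6.
  rewrite /t rpredDr ?dvdzz // Gauss_dvdzr // rpredDl ?dvdz_mulr ?dvdzz //.
  by apply/negP => /dvdz_mod0P h; apply: hj; rewrite h mod0z.
have -> : (18%:Z * (\prod_(1 <= i < k.+2) p i ^ 2)%N%:Z * n%:Z
    + 3%:Z * (6%:Z * j + q%:Z) * P%:Z * q%:Z = 3%:Z * (P%:Z * (q%:Z * t)))%R.
  by rewrite big_nat_recr //= -/P -/q -mulnn !PoszM /t; ring.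
(* For negative arguments [Bbar] is 0 and the claim is immediate. *)
case e : (P%:Z * (q%:Z * t))%R => [m|m] //.
apply: num_overpart29_eq0 => x y; rewrite -e.
case/norm_descent_prod => [i /andP[i1 ik]|x' [y' {}e]]; first by apply: hp; rewrite i1 leqW.
(* After the descent [x'^2 + 3 y'^2 = q t]; as [q] divides both [x'] and [y'], [q^2] divides [q t],
   forcing [q] to divide [t]. *)
have [] := @inert_dvd_norm q x' y' q_pr q_gt4 q_mod3; first by rewrite e dvdz_mulr.
case/dvdzP => a xa /dvdzP[b yb]; case/negP: q_ndvd_t.
have q0 : (q%:Z != 0)%R by rewrite eqz_nat -lt0n prime_gt0.
apply/dvdzP; exists (a ^+ 2 + 3%:Z * b ^+ 2)%R; apply: (mulfI q0).
by rewrite -e xa yb; ring.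
Qed.
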